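(* Let $m$ be a positive integer and $k,n\in\mathbb{Z}$. Then $$\left\lfloor\frac{2kn}{m}\right\rfloor-\left\lfloor\frac{kn}{m}\right\rfloor+\left\lfloor\frac{(k-1)n}{m}\right\rfloor-\left\lfloor\frac{2(k-1)n}{m}\right\rfloor\ \geqslant\ \left\lfloor\frac{n+1}{m}\right\rfloor-\left\lfloor\frac{2k-1}{m}\right\rfloor+\left\lfloor\frac{2k-2}{m}\right\rfloor,$$ unless $m$ is even, $k\equiv m/2+1\pmod m$ and $n\equiv -1\pmod m$, in which case the left-hand side minus the right-hand side equals $-1$. *)

(* Defs.v *)
From mathcomp Require Import all_boot all_order all_algebra.

Set Implicit Arguments.
Unset Strict Implicit.
Unset Printing Implicit Defensive.

Import GRing.Theory Num.Theory.
Local Open Scope ring_scope.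

Definition floor_frac (a m : int) : int := Num.floor (a%:Q / m%:Q).

Definition lhs (m k n : int) : int :=
  floor_frac (2 * k * n) m - floor_frac (k * n) m
  + floor_frac ((k - 1) * n) m - floor_frac (2 * (k - 1) * n) m.

Definition rhs (m k n : int) : int :=
  floor_frac (n + 1) m - floor_frac (2 * k - 1) m + floor_frac (2 * k - 2) m.

(* [(m %/ 2)%Z] is the exact half of [m], since [m] is required to be even. *)
Definition exceptional (m k n : int) : Prop :=
  [/\ (2 %| m)%Z, (k = (m %/ 2)%Z + 1 %[mod m])%Z & (n = -1 %[mod m])%Z].

(* Main.v *)
Require Import Defs.
From mathcomp Require Import all_boot all_order all_algebra.
From mathcomp Require Import zify ring.
Local Open Scope ring_scope.

(** By Hermite's identity [2x/m] - [x/m] is the nearest-integer rounding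
    r(x) = [(x + [m/2]) / m], which is nondecreasing and satisfies
    r(x + cm) = r(x) + c.  The left-hand side is thus r(x + n) - r(x) with
    x = (k - 1)n, and the right-hand side is [(n + 1)/m] - (m | 2k - 1),
    truth values counting as 0 or 1.
    If n = am + s with 0 <= s < m - 1, monotonicity gives at least a.  If
    n = bm - 1, the left-hand side is b - (m | 1 - k + [m/2]); for odd m this
    divisibility is equivalent to m | 2k - 1, while for even m it is the
    exceptional case. *)

Import Order.TTheory GRing.Theory Num.Theory.

Lemma floor_fracE (a m : int) : 0 < m -> floor_frac a m = (a %/ m)%Z.
Proof.
move=> m_gt0; apply: floor_def.
have mQ : 0 < m%:~R :> rat by rewrite ltr0z.
rewrite ler_pdivlMr // ltr_pdivrMr // -!intrM ler_int ltr_int.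
have := divz_eq a m; have := modz_ge0 a (lt0r_neq0 m_gt0).
have := ltz_pmod a m_gt0; lia.
Qed.

Lemma divz_unique (m a q : int) :
  q * m <= a < (q + 1) * m -> (a %/ m)%Z = q.
Proof.
move=> /andP[lo hi]; have m_gt0 : 0 < m by lia.
have -> : a = q * m + (a - q * m) by ring.
rewrite divzMDl ?lt0r_neq0 // [X in _ + X]divz_small ?addr0 //.
by lia.
Qed.

Lemma divz_succ (m y : int) :
  0 < m -> ((y + 1) %/ m)%Z = (y %/ m)%Z + (m %| y + 1)%Z%:Z.
Proof.
move=> m_gt0; have := divz_eq y m.
have := modz_ge0 y (lt0r_neq0 m_gt0); have := ltz_pmod y m_gt0.
set q := (y %/ m)%Z; set r := (y %% m)%Z => r_lt r_ge0 ->.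
have dvd_r : (m %| q * m + r + 1)%Z = (r + 1 == m).
  rewrite -addrA rpredDl ?dvdz_mull //.
  apply/idP/eqP => [|->]; last exact: dvdzz.
  by rewrite dvdzE => /dvdn_leq; lia.
rewrite dvd_r; apply: divz_unique.
by case: eqP => /= ?; rewrite !mulrDl ?mul0r ?mul1r ?addr0; lia.
Qed.

Lemma divz_double_sub (m x : int) : 0 < m ->
  ((2 * x) %/ m)%Z - (x %/ m)%Z = ((x + (m %/ 2)%Z) %/ m)%Z.
Proof.
move=> m_gt0; have := divz_eq x m.
have := modz_ge0 x (lt0r_neq0 m_gt0); have := ltz_pmod x m_gt0.
set q := (x %/ m)%Z; set r := (x %% m)%Z => r_lt r_ge0 ->.
(* For either parity of [m], adding [m %/ 2] to the remainder [r] reaches [m] exactly when doubling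
   [r] does. *)
have [small|big] := ltP (2 * r) m.
  rewrite (@divz_unique m (2 * _) (2 * q)); last by lia.
  by rewrite (@divz_unique m _ q); lia.
rewrite (@divz_unique m (2 * _) (2 * q + 1)); last by lia.
by rewrite (@divz_unique m _ (q + 1)); lia.
Qed.

Lemma lhsE (m k n : int) : 0 < m ->
  lhs m k n = (((k - 1) * n + n + (m %/ 2)%Z) %/ m)%Z
            - (((k - 1) * n + (m %/ 2)%Z) %/ m)%Z.
Proof.
move=> m_gt0; rewrite /lhs !floor_fracE // -!divz_double_sub //.
have -> : (k - 1) * n + n = k * n by ring.
by rewrite !mulrA opprB addrA.
Qed.

Lemma rhsE (m k n : int) : 0 < m ->
  rhs m k n = ((n + 1) %/ m)%Z - (m %| 2 * k - 1)%Z%:Z.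
Proof.
move=> m_gt0; rewrite /rhs !floor_fracE //.
have -> : 2 * k - 1 = 2 * k - 2 + 1 by ring.
by rewrite [X in _ - X]divz_succ //; lia.
Qed.

(** Since [n] is [-1] modulo [m], the two rounded arguments reduce to the consecutive integers
    [- k + m %/ 2] and its successor, so [divz_succ] applies; the extracted multiples [k * b] and
    [(k - 1) * b] differ by [b], which cancels [(n + 1) %/ m]. *)
Lemma lhs_sub_rhs_pred (m k b : int) : 0 < m ->
  lhs m k (b * m - 1) - rhs m k (b * m - 1)
  = (m %| 2 * k - 1)%Z%:Z - (m %| 1 - k + (m %/ 2)%Z)%Z%:Z.
Proof.
move=> m_gt0; have m_neq0 := lt0r_neq0 m_gt0.
rewrite lhsE // rhsE // subrK mulzK //.
have -> : (k - 1) * (b * m - 1) + (b * m - 1) + (m %/ 2)%Z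
          = (k * b) * m + (- k + (m %/ 2)%Z) by ring.
have -> : (k - 1) * (b * m - 1) + (m %/ 2)%Z
          = ((k - 1) * b) * m + (- k + (m %/ 2)%Z + 1) by ring.
rewrite !divzMDl // divz_succ //.
have -> : - k + (m %/ 2)%Z + 1 = 1 - k + (m %/ 2)%Z by ring.
by ring.
Qed.

(** Here 2 is invertible modulo [m], and doubling the left-hand number gives [m - (2 * k - 1)]. *)
Lemma dvdz_half_odd (m k : int) : ~~ (2 %| m)%Z ->
  (m %| 1 - k + (m %/ 2)%Z)%Z = (m %| 2 * k - 1)%Z.
Proof.
move=> m_odd; have mE : m = 2 * (m %/ 2)%Z + 1 by lia.
have co : coprimez m 2.
  by apply/coprimezP; exists (1, - (m %/ 2)%Z) => /=; lia.
rewrite -(Gauss_dvdzr _ co).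
have -> : 2 * (1 - k + (m %/ 2)%Z) = m - (2 * k - 1) by lia.
by rewrite rpredBl ?dvdzz.
Qed.

(** The congruence on [n] is automatic here, and the one on [k] becomes the divisibility occurring
    in [lhs_sub_rhs_pred]. *)
Lemma exceptionalP (m k b : int) :
  exceptional m k (b * m - 1) <-> (2 %| m)%Z /\ (m %| 1 - k + (m %/ 2)%Z)%Z.
Proof.
have kE : (m %| 1 - k + (m %/ 2)%Z)%Z = (k == (m %/ 2)%Z + 1 %[mod m])%Z.
  have -> : 1 - k + (m %/ 2)%Z = - (k - ((m %/ 2)%Z + 1)) by ring.
  by rewrite rpredN eqz_mod_dvd.
rewrite kE; split=> [[m_even /eqP kmod _] //|[m_even /eqP kmod]].
by split=> //; rewrite modzMDl.
Qed.

Theorem theorem2p1 (m k n : int) (hm : 0 < m) :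
  (~ exceptional m k n -> lhs m k n >= rhs m k n) /\
  (exceptional m k n -> lhs m k n - rhs m k n = -1).
Proof.
have [/dvdzP[b nE]|n_neq] := boolP (m %| n + 1)%Z.
  have -> : n = b * m - 1 by rewrite -nE addrK.
  have diffE := @lhs_sub_rhs_pred m k b hm.
  rewrite exceptionalP; split=> [nexc|[m_even m_dvd]].
    rewrite -subr_ge0 diffE.
    have [m_even|m_odd] := boolP (2 %| m)%Z; last first.
      by rewrite dvdz_half_odd // subrr.
    have /negPf -> : ~~ (m %| 1 - k + (m %/ 2)%Z)%Z by apply/negP => ?; apply: nexc.
    by rewrite subr0.
  rewrite diffE m_dvd.
  (* An even [m] cannot divide an odd number, so the difference is [0 - 1]. *)
  have /negPf -> // : ~~ (m %| 2 * k - 1)%Z.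
  by apply/negP => /(dvdz_trans m_even); lia.
split=> [_|[_ _ /eqP]]; last by rewrite eqz_mod_dvd opprK (negPf n_neq).
(* As [m] does not divide [n + 1], the right-hand side is [n %/ m] minus a term that is 0 or 1,
   hence at most [n %/ m]. *)
rewrite lhsE // rhsE // divz_succ // (negPf n_neq) addr0.
have nE := divz_eq n m; have s_ge0 := modz_ge0 n (lt0r_neq0 hm).
have -> : (k - 1) * n + n + (m %/ 2)%Z
  = (n %/ m)%Z * m + ((k - 1) * n + (m %/ 2)%Z + (n %% m)%Z).
  by rewrite {2}nE; ring.
rewrite divzMDl ?lt0r_neq0 //.
set x := (k - 1) * n + _.
have : (x %/ m)%Z <= ((x + (n %% m)%Z) %/ m)%Z by apply: lez_pdiv2r; lia.
lia.
Qed.
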